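(* Let $s\ge 2$ and let $H_1,\dots,H_s$ be pairwise vertex-disjoint connected finite simple graphs. Assume that for each $1\le i\le s$ there is a vertex $v_i\in V(H_i)$ such that $v_i$ is covered by every maximal matching $M$ of $H_i$ with $|M|=\mathrm{min\text{-}match}(H_i)$. Let $v$ be a new vertex and let $G$ be the graph with $V(G)=\bigcup_{i=1}^s V(H_i)\cup\{v\}$ and $E(G)=\bigcup_{i=1}^s E(H_i)\cup\{\{v_i,v\}:1\le i\le s\}$. Then $\mathrm{min\text{-}match}(G)=\sum_{i=1}^s\mathrm{min\text{-}match}(H_i)$.
   Context: A matching is a set of pairwise disjoint edges; a maximal matching is a matching not properly contained in another matching; a vertex is covered by a matching if it lies in one of its edges. $\mathrm{min\text{-}match}$ denotes the minimum size of a maximal matching. *)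

(* Defs.v *)
From HB Require Import structures.
From mathcomp Require Import all_boot.

Set Implicit Arguments.
Unset Strict Implicit.
Unset Printing Implicit Defensive.

Record sgraph := SGraph {
  vertex :> finType;
  adj : rel vertex;
  adj_sym : symmetric adj;
  adj_irrefl : irreflexive adj }.

Definition connected_graph (G : sgraph) : Prop :=
  0 < #|G| /\ forall x y : G, connect (@adj G) x y.

Definition edges (G : sgraph) : {set {set G}} :=
  [set [set p.1; p.2] | p : G * G & adj p.1 p.2].

Definition matching (G : sgraph) (M : {set {set G}}) : bool :=
  (M \subset edges G) && trivIset M.

Definition maximal_matching (G : sgraph) (M : {set {set G}}) : bool :=
  maxset (@matching G) M.

Definition covered (G : sgraph) (x : G) (M : {set {set G}}) : bool :=
  x \in cover M.

Lemma maximal_matching_size_ex (G : sgraph) :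
  exists k, [exists M : {set {set G}}, maximal_matching M && (#|M| == k)].
Proof.
have h0 : matching (set0 : {set {set G}}).
  by rewrite /matching sub0set /=; apply/trivIsetP => A B; rewrite inE.
have [M maxM _] := maxset_exists h0.
by exists #|M|; apply/existsP; exists M; rewrite eqxx andbT.
Qed.

Definition min_match (G : sgraph) : nat := ex_minn (maximal_matching_size_ex G).

(* The disjoint union of the H i is the tagged sum {i : 'I_s & H i}, vertex u  *)
(* of H i being Some (Tagged _ u); the new vertex is None.                     *)
Section Join.
Variables (s : nat) (H : 'I_s -> sgraph) (v : forall i, H i).

(* tagged_as a b is tagged b seen in H (tag a), meaningful when tags agree. *)
Definition join_adj : rel (option {i : 'I_s & H i}) := fun x y =>
  match x, y with
  | Some a, Some b => (tag a == tag b) && adj (tagged a) (tagged_as a b)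
  | Some a, None => tagged a == v (tag a)
  | None, Some b => tagged b == v (tag b)
  | None, None => false
  end.

Lemma join_adj_sym : symmetric join_adj.
Proof.
case=> [[i x]|] [[j y]|] //=; rewrite eq_sym.
by case: eqP => //= eji; case: i / eji x => x; rewrite !tagged_asE adj_sym.
Qed.

Lemma join_adj_irrefl : irreflexive join_adj.
Proof. by case=> [[i x]|] //=; rewrite tagged_asE adj_irrefl andbF. Qed.

Definition join_graph : sgraph := SGraph join_adj_sym join_adj_irrefl.

End Join.

(* Main.v *)
(* For the upper bound, the union of minimum maximal matchings of the H i     *)
(* covers every v i, so it blocks the edges at the new vertex as well and is   *)
(* maximal in G. For the lower bound, restrict a maximal matching M of G to    *)
(* each H i. The restriction is maximal unless M contains {v, v i}; this       *)
(* happens for at most one i, where all the unblocked edges of H i meet v i,   *)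
(* so adding any one of them yields a maximal matching. That loss of 1 is made *)
(* up for by the edge {v, v i} of M itself.                                    *)
Require Import Defs.
From mathcomp Require Import all_boot.

Set Implicit Arguments.
Unset Strict Implicit.
Unset Printing Implicit Defensive.

(** Both bounds rest on [maximal_matchingP]: a matching is maximal exactly when every edge has a
    covered endpoint. An edge of the join lies in one copy of some [H i] or joins [None] to some
    [v i]; the latter edges all share [None], so a matching has at most one. [min_match_join_le]
    glues matchings of the [H i] with [lift_edges]; [min_match_join_ge] cuts a matching of the join
    with [restrict_edges] and treats the one exceptional copy by [min_match_leS]. *)

Section MaximalMatching.
Variable G : sgraph.
Implicit Types (x y : G) (e : {set G}) (M : {set {set G}}).

Lemma edgesP e :
  reflect (exists x y, adj x y /\ e = [set x; y]) (e \in edges G).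
Proof.
apply: (iffP imsetP) => [[[x y]]|[x [y [xy ->]]]].
  by rewrite inE /= => xy ->; exists x, y.
by exists (x, y); rewrite ?inE.
Qed.

Lemma set0_notin_edges : set0 \notin edges G.
Proof.
by apply/edgesP=> -[x [y [_ /setP/(_ x)]]]; rewrite !inE eqxx.
Qed.

Lemma set0_notin_matching M : matching M -> set0 \notin M.
Proof.
by case/andP=> /subsetP sM _; apply: contra set0_notin_edges => /sM.
Qed.

Lemma matching_eq M e1 e2 x : matching M -> e1 \in M -> e2 \in M ->
  x \in e1 -> x \in e2 -> e1 = e2.
Proof.
case/andP=> _ /trivIsetP tM e1M e2M x1 x2; apply/eqP.
by apply: contraLR x2 => /(tM _ _ e1M e2M)/disjointFr ->.
Qed.

Lemma matchingU1 M x y : matching M -> adj x y ->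
  x \notin cover M -> y \notin cover M -> matching ([set x; y] |: M).
Proof.
move=> mM xy xM yM; have M0 := set0_notin_matching mM.
case/andP: mM => sM tM; apply/andP; split.
  by rewrite subUset sub1set sM andbT; apply/edgesP; exists x, y.
apply: (proj1 (trivIsetU1 _ tM M0)) => B BM.
rewrite disjoints_subset; apply/subsetP=> z; rewrite !inE => zxy.
apply/negP=> zB; have zM: z \in cover M by apply/bigcupP; exists B.
by case/orP: zxy zM => /eqP ->; rewrite ?(negPf xM) ?(negPf yM).
Qed.

(** An edge with two uncovered ends could be added. Conversely, an edge of a larger matching that
    meets an edge of [M] must equal it, by disjointness. *)
Lemma maximal_matchingP M :
  reflect (matching M /\
           forall x y, adj x y -> (x \in cover M) || (y \in cover M))
          (maximal_matching M).
Proof.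
apply: (iffP maxsetP) => -[mM maxM].
  split=> // x y xy; apply: contraT; rewrite negb_or => /andP[xM yM].
  have eM := maxM _ (matchingU1 mM xy xM yM) (subsetUr _ _).
  case/negP: xM; apply/bigcupP; exists [set x; y]; last by rewrite set21.
  by rewrite -eM setU11.
split=> // N mN sMN.
apply/eqP; rewrite eqEsubset sMN andbT; apply/subsetP=> e eN.
have /edgesP[x [y [xy def_e]]]: e \in edges G.
  by case/andP: mN => /subsetP-> //.
have in_M z : z \in e -> z \in cover M -> e \in M.
  move=> ze /bigcupP[e' e'M ze'].
  by rewrite (matching_eq mN eN (subsetP sMN _ e'M) ze ze').
by case/orP: (maxM _ _ xy); apply: in_M; rewrite def_e ?set21 ?set22.
Qed.

Lemma min_match_le M : maximal_matching M -> min_match G <= #|M|.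
Proof.
move=> maxM; rewrite /min_match; case: ex_minnP => k _; apply.
by apply/existsP; exists M; rewrite maxM eqxx.
Qed.

(** Stated in [Type], so that a minimum maximal matching can be picked for all [H i] at once. *)
Lemma min_match_ex :
  {M : {set {set G}} | maximal_matching M & #|M| = min_match G}.
Proof.
apply: sig2_eqW; rewrite /min_match.
case: ex_minnP => k /existsP[M /andP[maxM /eqP cM]] _.
by exists M.
Qed.

(** An edge missed by [M] must contain [w]; adding it covers [w], hence every other missed edge as
    well. *)
Lemma min_match_leS M w : matching M ->
  (forall x y, adj x y ->
     [|| x \in cover M, y \in cover M, x == w | y == w]) ->
  min_match G <= #|M|.+1.
Proof.
move=> mM domM.
have [/min_match_le/leqW //|nmaxM] := boolP (maximal_matching M).
have [/existsP[[x y]]|] := boolP [exists p : G * G,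
    [&& adj p.1 p.2, p.1 \notin cover M & p.2 \notin cover M]]; last first.
  rewrite negb_exists => /forallP nex; case/maximal_matchingP: nmaxM.
  split=> // x y xy; move: (nex (x, y)).
  by rewrite /= xy /= negb_and !negbK.
case/and3P=> /= xy xM yM; set M' := [set x; y] |: M.
have cM' : cover M' = [set x; y] :|: cover M.
  by rewrite /cover bigcup_setU big_set1.
have w_xy : w \in [set x; y].
  by have := domM _ _ xy; rewrite (negPf xM) (negPf yM) !inE !(eq_sym w).
have maxM' : maximal_matching M'.
  apply/maximal_matchingP; split=> [|a b /domM]; first exact: matchingU1.
  rewrite !cM' !(in_setU _ _ (cover M)).
  by case/or4P=> [-> | -> | /eqP-> | /eqP->]; rewrite ?w_xy ?orbT.
by rewrite (leq_trans (min_match_le maxM')) // cardsU1; case: (_ \notin _).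
Qed.

End MaximalMatching.

Section Join.
Variables (s : nat) (H : 'I_s -> sgraph) (v : forall i, H i).
Local Notation G := (join_graph v).

Definition join_inj i (u : H i) : G := Some (Tagged (fun i => H i : Type) u).

Lemma join_injI i : injective (@join_inj i).
Proof.
by move=> x y [/eqP]; rewrite -tag_eqE /tag_eq eqxx tagged_asE /= => /eqP.
Qed.

Lemma join_inj_tag i j (x : H i) (y : H j) : join_inj x = join_inj y -> i = j.
Proof. by move=> []. Qed.

Definition lift_edges i (N : {set {set H i}}) : {set {set G}} :=
  [set (@join_inj i) @: e | e : {set H i} in N].

(** Edges at the new vertex drop out, since no image under [join_inj] contains [None]. *)
Definition restrict_edges i (M : {set {set G}}) : {set {set H i}} :=
  [set e : {set H i} | @join_inj i @: e \in M].

Lemma join_edge_inj i (e : {set H i}) :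
  (@join_inj i @: e \in edges G) = (e \in edges (H i)).
Proof.
apply/edgesP/edgesP=> -[x [y [xy def_e]]]; last first.
  exists (join_inj x), (join_inj y); split; first by rewrite /= eqxx tagged_asE.
  by rewrite def_e imsetU1 imset_set1.
have /imsetP[x' x'e def_x] : x \in @join_inj i @: e by rewrite def_e set21.
have /imsetP[y' y'e def_y] : y \in @join_inj i @: e by rewrite def_e set22.
exists x', y'; split; first by move: xy; rewrite def_x def_y /= eqxx tagged_asE.
apply: (imset_inj (@join_injI i)).
by rewrite def_e def_x def_y imsetU1 imset_set1.
Qed.

Lemma join_edgeP (e : {set G}) : e \in edges G ->
  (exists i (e' : {set H i}), e = @join_inj i @: e')
  \/ exists i, e = [set None; join_inj (v i)].
Proof.
case/edgesP=> -[[i x]|] [[[j y]|] [//= xy ->]]; last 2 first.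
- by right; exists i; rewrite setUC (eqP xy).
- by right; exists j; rewrite (eqP xy).
case/andP: xy => /eqP eij _; case: j / eij y => y.
by left; exists i, [set x; y]; rewrite imsetU1 imset_set1.
Qed.

Lemma mem_cover_lift (N : forall i, {set {set H i}}) i (u : H i) :
  (join_inj u \in cover (\bigcup_j lift_edges (N j))) = (u \in cover (N i)).
Proof.
apply/bigcupP/bigcupP=> [[_ /bigcupP[j _ /imsetP[e eN ->]]]|[e eN ue]].
  case/imsetP=> w we euw; have eij := join_inj_tag euw.
  case: j / eij e eN w we euw => e eN w we /join_injI->.
  by exists e.
exists (@join_inj i @: e); last exact: imset_f.
by apply/bigcupP; exists i => //; apply: imset_f.
Qed.

(** A nonempty set determines the copy it lives in, whereas [set0] has the same image from every
    copy and would be counted only once. *)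
Lemma card_bigcup_lift (N : forall i, {set {set H i}}) :
  (forall i, set0 \notin N i) ->
  #|\bigcup_i lift_edges (N i)| = \sum_i #|N i|.
Proof.
move=> N0; rewrite -sum1_card partition_disjoint_bigcup => [|i j nij].
  apply: eq_bigr => i _; rewrite sum1_card card_imset //.
  exact/imset_inj/join_injI.
apply/pred0P=> e /=; apply: contraNF nij.
case/andP=> /imsetP[a aN ->] /imsetP[b bN eab].
have [a0|[x xa]] := set_0Vmem a; first by rewrite a0 (negPf (N0 i)) in aN.
have /imsetP[y _ /join_inj_tag->] // : join_inj x \in @join_inj j @: b.
by rewrite -eab imset_f.
Qed.

Lemma disjoint_join_inj i j (a : {set H i}) (b : {set H j}) :
  i != j -> [disjoint @join_inj i @: a & @join_inj j @: b].
Proof.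
move=> nij; apply/pred0P=> x /=; apply: contraNF nij.
by case/andP=> /imsetP[y _ ->] /imsetP[z _ /join_inj_tag->].
Qed.

Lemma matching_bigcup_lift (N : forall i, {set {set H i}}) :
  (forall i, matching (N i)) ->
  matching (\bigcup_i lift_edges (N i) : {set {set G}}).
Proof.
move=> mN; apply/andP; split.
  apply/bigcupsP=> i _; apply/subsetP=> _ /imsetP[e eN ->].
  by rewrite join_edge_inj; case/andP: (mN i) => /subsetP->.
apply/trivIsetP=> _ B /bigcupP[i _ /imsetP[a aN ->]].
move=> /bigcupP[j _ /imsetP[b bN ->]] {B}.
have [eij|nij _] := eqVneq i j; last exact: disjoint_join_inj.
case: j / eij b bN => b bN; rewrite imset_disjoint; last exact: join_injI.
rewrite (inj_eq (imset_inj (@join_injI i))) => nab.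
by case/andP: (mN i) => _ /trivIsetP->.
Qed.

Lemma matching_restrict i (M : {set {set G}}) :
  matching M -> matching (restrict_edges i M).
Proof.
case/andP=> /subsetP sM /trivIsetP tM; apply/andP; split.
  by apply/subsetP=> e; rewrite inE -join_edge_inj => /sM.
apply/trivIsetP=> a b; rewrite !inE => aM bM nab.
rewrite -(imset_disjoint (@join_injI i)) tM //.
by rewrite (inj_eq (imset_inj (@join_injI i))).
Qed.

Lemma bigcup_lift_restrict (M : {set {set G}}) :
  \bigcup_i lift_edges (restrict_edges i M) \subset M.
Proof.
by apply/bigcupsP=> i _; apply/subsetP=> _ /imsetP[e + ->]; rewrite inE.
Qed.

(** Restriction can uncover a vertex only by losing its edge to [None], and in copy [i] only [v i]
    has such an edge. *)
Lemma mem_cover_restrict (M : {set {set G}}) i (u : H i) : matching M ->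
  join_inj u \in cover M ->
  u \in cover (restrict_edges i M) \/
  u = v i /\ [set None; join_inj (v i)] \in M.
Proof.
move=> mM /bigcupP[e eM ue]; have /join_edgeP: e \in edges G.
  by case/andP: mM => /subsetP->.
case=> [[j [e' def_e]]|[j def_e]]; rewrite {}def_e in eM ue.
  left; case/imsetP: ue => w we euw; have eij := join_inj_tag euw.
  case: j / eij e' eM w we euw => e' eM w we /join_injI ->.
  by apply/bigcupP; exists e'; rewrite ?inE.
right; move: ue; rewrite in_set2 /= => /eqP euv; have eij := join_inj_tag euv.
by case: j / eij eM euv => eM /join_injI ->.
Qed.

Lemma min_match_join_le :
  (forall i (M : {set {set H i}}), maximal_matching M ->
     #|M| = min_match (H i) -> covered (v i) M) ->
  min_match G <= \sum_i min_match (H i).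
Proof.
move=> hv; pose N i := s2val (min_match_ex (H i)).
have maxN i : maximal_matching (N i) by rewrite /N; case: min_match_ex.
have cN i : #|N i| = min_match (H i) by rewrite /N; case: min_match_ex.
have mN i : matching (N i) by case/maximal_matchingP: (maxN i).
rewrite -(eq_bigr _ (fun i _ => cN i)) -card_bigcup_lift => [|i]; last first.
  exact: set0_notin_matching.
apply/min_match_le/maximal_matchingP; split; first exact: matching_bigcup_lift.
(* Edges at [None] end in some [v i], covered by [hv] because [N i] has minimum size; the others are
   dominated inside their copy. *)
move=> [[i x]|] [[j y]|] //= xy; last 2 first.
- by rewrite (@mem_cover_lift N i x) (eqP xy) [_ \in cover (N i)]hv.
- by rewrite (@mem_cover_lift N j y) (eqP xy) [_ \in cover (N j)]hv ?orbT.
case/andP: xy => /eqP eij; case: j / eij y => y; rewrite tagged_asE => xy.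
rewrite (@mem_cover_lift N i x) (@mem_cover_lift N i y).
by case/maximal_matchingP: (maxN i) => _; apply.
Qed.

Lemma min_match_join_ge : \sum_i min_match (H i) <= min_match G.
Proof.
have [M maxM <-] := min_match_ex G.
have [mM domM] := maximal_matchingP _ maxM.
pose N i := restrict_edges i M; pose L := \bigcup_i lift_edges (N i).
have mN i : matching (N i) by apply: matching_restrict.
have cL : #|L| = \sum_i #|N i|.
  by apply: card_bigcup_lift => i; apply: set0_notin_matching.
pose star j := [set None; join_inj (v j)] : {set G}.
have domN i x y : adj x y ->
    (x \in cover (N i)) || (y \in cover (N i)) ||
     (star i \in M) && ((x == v i) || (y == v i)).
  move=> xy; have /domM : adj (join_inj x) (join_inj y).
    by rewrite /= eqxx tagged_asE.
  by case/orP=> /(mem_cover_restrict mM)[-> | [-> ->]]; rewrite ?eqxx ?orbT.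
have maxN i : star i \notin M -> min_match (H i) <= #|N i|.
  move=> sM; apply/min_match_le/maximal_matchingP; split=> // x y /domN.
  by rewrite (negPf sM) orbF.
have [/existsP[j jM]|] := boolP [exists j, star j \in M]; last first.
  rewrite negb_exists => /forallP nM.
  apply: leq_trans (subset_leq_card (bigcup_lift_restrict M)).
  by rewrite [#|_|]cL; apply: leq_sum => i _; apply: maxN.
(* [star j] contains [None] and no lifted edge does, so it contributes one more edge to the
   count. *)
have jL : star j \notin L.
  apply/negP=> /bigcupP[i _ /imsetP[e _ /setP/(_ None)]].
  by rewrite set21 => /esym/imsetP[].
apply: (@leq_trans #|star j |: L|); last first.
  by rewrite subset_leq_card // subUset sub1set jM bigcup_lift_restrict.
(* The extra 1 is grouped with copy [j], where it absorbs the loss allowed by [min_match_leS]. *)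
rewrite cardsU1 jL cL (bigD1 j) //= [X in _ <= _ + X](bigD1 j) //= addnA.
apply: leq_add.
  apply: (@min_match_leS _ _ (v j)) => // x y /domN.
  by case/orP=> [/orP[]->|/andP[_ /orP[]->]]; rewrite ?orbT.
apply: leq_sum => i nij; apply: maxN; apply: contra nij => iM.
(* [star i] and [star j] share [None], so both lying in [M] forces them to coincide, whence
   [i = j]. *)
have /setP/(_ (join_inj (v i))) := matching_eq mM iM jM (set21 _ _) (set21 _ _).
by rewrite set22 in_set2 /= => /esym/eqP/join_inj_tag->.
Qed.

End Join.

Theorem theorem1p10 (s : nat) (H : 'I_s -> sgraph) (v : forall i : 'I_s, H i)
  (hs : 2 <= s)
  (hconn : forall i : 'I_s, connected_graph (H i))
  (hv : forall (i : 'I_s) (M : {set {set H i}}),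
      maximal_matching M -> #|M| = min_match (H i) -> covered (v i) M) :
  min_match (join_graph v) = \sum_(i < s) min_match (H i).
Proof.
by apply/eqP; rewrite eqn_leq min_match_join_le // min_match_join_ge.
Qed.
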